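(* Let $H,K$ be Hilbert spaces and let $T$ be a densely defined closable operator from $D(T)\subset H$ into $K$ which has decomposable domain, $D(T)=N(T)\oplus^{\perp}C(T)$ (no assumption that $N(\overline{T})=\overline{N(T)}$ is made). Then $(T^{*}T)^{\dagger}\supset T^{\dagger}(T^{*})^{\dagger}$.
   Context: Operators are linear and defined on a linear subspace $D(T)$ (the domain) of a Hilbert space; $N(T)$ and $R(T)$ are the null space and range. The carrier of $T$ is $C(T)=D(T)\cap N(T)^{\perp}$. $\oplus^{\perp}$ denotes orthogonal direct sum of subspaces. $T$ has decomposable domain if $D(T)=N(T)\oplus^{\perp}C(T)$; every closed operator has decomposable domain, since its null space is closed. For $T$ with decomposable domain, the Moore-Penrose (generalized) inverse is the linear operator $T^{\dagger}:D(T^{\dagger})=R(T)\oplus^{\perp}R(T)^{\perp}\subset K\to H$ determined by $T^{\dagger}y=(T|_{C(T)})^{-1}y$ for $y\in R(T)$ and $T^{\dagger}y=0$ for $y\in R(T)^{\perp}$. The assertion is understood to include that the operators to which $\dagger$ is applied have decomposable domain. $T$ is closable if it has a closed extension; $\overline{T}$ is its minimal closed extension. $T^{*}$ is the adjoint of a densely defined operator. Products have natural domain $D(AB)=\{x\in D(B):Bx\in D(A)\}$. $B\supset A$ for operators means that $B$ extends $A$: $D(A)\subset D(B)$ and $Bx=Ax$ for $x\in D(A)$. *)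

(* Defs.v *)
From HB Require Import structures.
From mathcomp Require Import all_boot all_order all_algebra.
From mathcomp Require Import sesquilinear complex.
From mathcomp Require Import boolp classical_sets reals topology normedtype.

Set Implicit Arguments.
Unset Strict Implicit.
Unset Printing Implicit Defensive.

Import Order.TTheory GRing.Theory Num.Theory.
Import numFieldNormedType.Exports.

Local Open Scope classical_set_scope.
Local Open Scope ring_scope.

Inductive real_or_complex (R : realType) :
    forall F : numFieldType, involutive_rmorphism F -> Prop :=
  | scalars_real : @real_or_complex R R (@idfun R : involutive_rmorphism R)
  | scalars_complex :
      @real_or_complex R R[i] (@Num.conj R[i] : involutive_rmorphism R[i]).

(* The inner product is linear in its first argument and semilinear (with
   respect to [theta]) in its second one. *)
Record hilbertType (F : numFieldType) (theta : involutive_rmorphism F) :=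
  Hilbert {
    hilbert_sort :> completeNormedModType F;
    inner : {dot hilbert_sort for theta};
    norm_innerE : forall x : hilbert_sort, `|x| ^+ 2 = inner x x
  }.
Arguments inner {F theta h}.

Section Hilbert.
Variables (F : numFieldType) (theta : involutive_rmorphism F).
Variable H : hilbertType theta.
Implicit Types (A B : set H) (x y : H).

Definition orthocompl A : set H := [set x : H | forall a, A a -> inner x a = 0].

(* Sum of subspaces; orthogonality is not recorded, as it holds by
   construction wherever [orthosum] is used below. *)
Definition orthosum A B : set H := [set x + y | x in A & y in B].

Lemma innerC x y : inner x y = theta (inner y x).
Proof. by rewrite [LHS]hermC expr0 mul1r. Qed.

Lemma inner_linearl a x y z :
  inner (a *: x + y) z = a * inner x z + inner y z.
Proof. exact: (linearPl (inner : {dot H for theta})). Qed.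

Lemma inner_linearr a x y z :
  inner x (a *: y + z) = theta a * inner x y + inner x z.
Proof. by rewrite innerC inner_linearl rmorphD rmorphM /= -!innerC. Qed.

Lemma innerBl x y z : inner (x - y) z = inner x z - inner y z.
Proof. by rewrite addrC -scaleN1r inner_linearl mulN1r addrC. Qed.

Lemma innerBr x y z : inner x (y - z) = inner x y - inner x z.
Proof. by rewrite innerC innerBl rmorphB /= -!innerC. Qed.

Lemma inner0r x : inner x 0 = 0.
Proof. by rewrite -[X in inner x X](subrr x) innerBr subrr. Qed.

Lemma inner0l x : inner 0 x = 0.
Proof. by rewrite innerC inner0r rmorph0. Qed.

Lemma inner_eq0C x y : inner x y = 0 -> inner y x = 0.
Proof. by move=> xy0; rewrite innerC xy0 rmorph0. Qed.

Lemma inner_self_eq0 x : inner x x = 0 -> x = 0.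
Proof.
move=> xx0; apply/eqP; rewrite -normr_eq0 -sqrf_eq0.
by apply/eqP; rewrite norm_innerE.
Qed.

Lemma orthocompl_linear A a x y :
  orthocompl A x -> orthocompl A y -> orthocompl A (a *: x + y).
Proof.
by move=> Ax Ay z Az; rewrite inner_linearl Ax// Ay// mulr0 addr0.
Qed.

Lemma dense_orthocompl A x : dense A -> orthocompl A x -> x = 0.
Proof.
move=> dA Ax; apply: contrapT => /eqP x0.
have e0 : 0 < `|x| by rewrite normr_gt0.
have [|z [xz Az]] := dA (ball x `|x|) _ (ball_open x `|x|).
  by exists x; exact: ballxx.
move: xz; rewrite -ball_normE /= => xz.
have : `|x| ^+ 2 <= `|x - z| ^+ 2.
  rewrite !norm_innerE innerBl !innerBr (Ax _ Az).
  rewrite (inner_eq0C (Ax _ Az)) subr0 sub0r opprK.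
  by rewrite lerDl -norm_innerE exprn_ge0.
by move=> /le_gtF; rewrite ltr_pXn2r ?nnegrE ?normr_ge0 ?xz.
Qed.

End Hilbert.

Section Operators.
Variables (F : numFieldType) (theta : involutive_rmorphism F).

(* [op_fun] is total, but its values outside [dom] carry no meaning. *)
Record operator (H K : hilbertType theta) := Operator {
  dom : set H;
  op_fun :> H -> K;
  dom0 : dom 0;
  dom_linear : forall a x y, dom x -> dom y -> dom (a *: x + y);
  op_linear : forall a x y, dom x -> dom y ->
    op_fun (a *: x + y) = a *: op_fun x + op_fun y
}.

Section Basic.
Variables H K : hilbertType theta.
Implicit Types S T : operator H K.

Definition extends S T :=
  dom T `<=` dom S /\ forall x, dom T x -> S x = T x.

Definition null T : set H := [set x | dom T x /\ T x = 0].

Definition ran T : set K := T @` dom T.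

Definition carrier T : set H := dom T `&` orthocompl (null T).

Definition decomposable_domain T := dom T = orthosum (null T) (carrier T).

Definition graph T : set (H * K)%type := [set p | dom T p.1 /\ p.2 = T p.1].

(* in the product topology of [H * K] *)
Definition closed_op T := closed (graph T).

Definition closable T := exists2 S, closed_op S & extends S T.

Definition densely_defined T := dense (dom T).

Lemma op0 T : T 0 = 0.
Proof.
have := op_linear 1 (dom0 T) (dom0 T).
by rewrite scaler0 addr0 scale1r => /esym/eqP; rewrite -subr_eq0 addrK => /eqP.
Qed.

Lemma domB T x y : dom T x -> dom T y -> dom T (x - y).
Proof. by move=> Tx Ty; rewrite addrC -scaleN1r; exact: dom_linear. Qed.

Lemma opB T x y : dom T x -> dom T y -> T (x - y) = T x - T y.
Proof.
by move=> Tx Ty; rewrite addrC -scaleN1r op_linear // scaleN1r addrC.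
Qed.

Lemma ran_linear T a x y : ran T x -> ran T y -> ran T (a *: x + y).
Proof.
move=> [u Tu <-] [v Tv <-]; exists (a *: u + v); first exact: dom_linear.
exact: op_linear.
Qed.

Lemma carrier_linear T a x y :
  carrier T x -> carrier T y -> carrier T (a *: x + y).
Proof.
move=> [Tx nx] [Ty ny]; split; first exact: dom_linear.
exact: orthocompl_linear.
Qed.

Lemma carrier_inj T x y : carrier T x -> carrier T y -> T x = T y -> x = y.
Proof.
move=> [Tx nx] [Ty ny] Txy; apply/eqP; rewrite -subr_eq0; apply/eqP.
apply: inner_self_eq0.
have nxy : null T (x - y) by split; [exact: domB|rewrite opB// Txy subrr].
by rewrite innerBl nx// ny// subr0.
Qed.

Lemma ran_carrier T : decomposable_domain T ->
  forall y, ran T y -> exists2 x, carrier T x & T x = y.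
Proof.
move=> hT y [x Tx <-]; move: (Tx); rewrite {1}hT => -[n [Tn n0]] [c Cc <-].
exists c => //; have Tc := Cc.1; apply/eqP; rewrite -subr_eq0 -opprB oppr_eq0.
by rewrite -opB ?addrK ?n0//; rewrite hT; exists n => //; exists c.
Qed.

End Basic.

Section Comp.
Variables (H K L : hilbertType theta) (A : operator K L) (B : operator H K).

Definition comp_dom : set H := [set x | dom B x /\ dom A (B x)].

Lemma comp_dom0 : comp_dom 0.
Proof. by split; rewrite ?op0; exact: dom0. Qed.

Lemma comp_dom_linear a x y :
  comp_dom x -> comp_dom y -> comp_dom (a *: x + y).
Proof.
move=> [Bx Ax] [By Ay]; split; first exact: dom_linear.
by rewrite op_linear//; exact: dom_linear.
Qed.

Lemma comp_op_linear a x y : comp_dom x -> comp_dom y ->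
  A (B (a *: x + y)) = a *: A (B x) + A (B y).
Proof. by move=> [Bx Ax] [By Ay]; rewrite !op_linear. Qed.

Definition op_comp : operator H L :=
  Operator comp_dom0 comp_dom_linear comp_op_linear.

End Comp.

Section Adjoint.
Variables (H K : hilbertType theta) (T : operator H K).
Hypothesis dT : densely_defined T.

Definition adj_rel (y : K) (z : H) :=
  forall x, dom T x -> inner (T x) y = inner x z.

Definition adj_dom : set K := [set y | exists z, adj_rel y z].

Definition adj_fun (y : K) : H := xget 0 [set z | adj_rel y z].

Lemma adj_relP y : adj_dom y -> adj_rel y (adj_fun y).
Proof. by move=> [z yz]; exact: (xgetI 0 yz). Qed.

Lemma adj_rel_linear a y y' z z' :
  adj_rel y z -> adj_rel y' z' -> adj_rel (a *: y + y') (a *: z + z').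
Proof.
by move=> yz yz' x Tx; rewrite !inner_linearr yz// yz'.
Qed.

Lemma adj_rel_uniq y z z' : adj_rel y z -> adj_rel y z' -> z = z'.
Proof.
move=> yz yz'; apply/eqP; rewrite -subr_eq0; apply/eqP.
apply: (dense_orthocompl dT) => x Tx; apply: inner_eq0C.
by rewrite innerBr -yz// -yz'// subrr.
Qed.

Lemma adj_dom0 : adj_dom 0.
Proof. by exists 0 => x _; rewrite !inner0r. Qed.

Lemma adj_dom_linear a x y : adj_dom x -> adj_dom y -> adj_dom (a *: x + y).
Proof.
by move=> [z xz] [z' yz']; exists (a *: z + z'); exact: adj_rel_linear.
Qed.

Lemma adj_op_linear a x y : adj_dom x -> adj_dom y ->
  adj_fun (a *: x + y) = a *: adj_fun x + adj_fun y.
Proof.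
move=> xD yD; apply: (@adj_rel_uniq (a *: x + y)).
  by apply: adj_relP; exact: adj_dom_linear.
by apply: adj_rel_linear; exact: adj_relP.
Qed.

Definition adjoint : operator K H :=
  Operator adj_dom0 adj_dom_linear adj_op_linear.

Lemma adjointP x y : dom T x -> dom adjoint y ->
  inner (T x) y = inner x (adjoint y).
Proof. by move=> Tx yD; exact: adj_relP. Qed.

End Adjoint.

Section MoorePenrose.
Variables (H K : hilbertType theta) (T : operator H K).

(* $(T|_{C(T)})^{-1}$, with junk value [0] outside [ran T] *)
Definition carrier_inv (y : K) : H :=
  xget 0 [set x | carrier T x /\ T x = y].

Hypothesis hT : decomposable_domain T.

Lemma carrier_invP y : ran T y ->
  carrier T (carrier_inv y) /\ T (carrier_inv y) = y.
Proof.
move=> /(ran_carrier hT)[x Cx Tx].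
exact: (@xgetI _ 0 [set x | carrier T x /\ T x = y] x (conj Cx Tx)).
Qed.

(* The values on [ran T] and on its orthogonal complement determine the
   Moore-Penrose inverse, see [mp_inverse_ran] and [mp_inverse_orthocompl]. *)
Definition mp_dom : set K := orthosum (ran T) (orthocompl (ran T)).

Definition mp_rel (y : K) (x : H) := exists y1 y2 : K,
  [/\ ran T y1, orthocompl (ran T) y2, y = y1 + y2 & x = carrier_inv y1].

Definition mp_fun (y : K) : H := xget 0 [set x | mp_rel y x].

Lemma mp_relP y : mp_dom y -> mp_rel y (mp_fun y).
Proof.
move=> [y1 Ty1 [y2 Ty2 yE]].
have yr : mp_rel y (carrier_inv y1) by exists y1, y2.
exact: (xgetI 0 yr).
Qed.

Lemma mp_rel_uniq y x x' : mp_rel y x -> mp_rel y x' -> x = x'.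
Proof.
move=> [y1 [y2 [Ty1 Ty2 -> ->]]] [z1 [z2 [Tz1 Tz2 yz ->]]].
suff -> : y1 = z1 by [].
have zy : y1 - z1 = z2 - y2.
  by apply/eqP; rewrite subr_eq addrAC eq_sym subr_eq addrC -yz.
have Tyz : ran T (y1 - z1).
  by rewrite addrC -scaleN1r; exact: ran_linear.
apply/eqP; rewrite -subr_eq0; apply/eqP; apply: inner_self_eq0.
by rewrite {1}zy innerBl Ty2// Tz2// subrr.
Qed.

Lemma mp_rel_linear a x y x' y' :
  mp_rel y x -> mp_rel y' x' -> mp_rel (a *: y + y') (a *: x + x').
Proof.
move=> [y1 [y2 [Ty1 Ty2 -> ->]]] [z1 [z2 [Tz1 Tz2 -> ->]]].
have Tyz : ran T (a *: y1 + z1) by exact: ran_linear.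
exists (a *: y1 + z1), (a *: y2 + z2); split => //.
- exact: orthocompl_linear.
- by rewrite scalerDr addrACA.
have [Cy yE] := carrier_invP Ty1; have [Cz zE] := carrier_invP Tz1.
have [Cyz yzE] := carrier_invP Tyz.
apply: (carrier_inj _ Cyz); first exact: carrier_linear.
by rewrite yzE op_linear ?yE ?zE//; [exact: Cy.1|exact: Cz.1].
Qed.

Lemma mp_dom0 : mp_dom 0.
Proof.
exists 0; first by exists 0; [exact: dom0|exact: op0].
by exists 0; [move=> y _; rewrite inner0l|rewrite addr0].
Qed.

Lemma mp_dom_linear a x y : mp_dom x -> mp_dom y -> mp_dom (a *: x + y).
Proof.
move=> [x1 Tx1 [x2 Tx2 <-]] [y1 Ty1 [y2 Ty2 <-]].
exists (a *: x1 + y1); first exact: ran_linear.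
exists (a *: x2 + y2); first exact: orthocompl_linear.
by rewrite scalerDr addrACA.
Qed.

Lemma mp_op_linear a x y : mp_dom x -> mp_dom y ->
  mp_fun (a *: x + y) = a *: mp_fun x + mp_fun y.
Proof.
move=> xD yD; apply: (@mp_rel_uniq (a *: x + y)).
  by apply: mp_relP; exact: mp_dom_linear.
by apply: mp_rel_linear; exact: mp_relP.
Qed.

Definition mp_inverse : operator K H :=
  Operator mp_dom0 mp_dom_linear mp_op_linear.

Lemma mp_inverse_ran y : ran T y -> mp_inverse y = carrier_inv y.
Proof.
move=> Ty; have yr : mp_rel y (carrier_inv y).
  exists y, 0; split; rewrite ?addr0// => z _.
  by rewrite inner0l.
exact: (mp_rel_uniq (xgetI 0 yr) yr).
Qed.

Lemma mp_inverse_orthocompl y : orthocompl (ran T) y -> mp_inverse y = 0.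
Proof.
move=> Ty; have T0 : ran T 0 by exists 0; [exact: dom0|exact: op0].
have yr : mp_rel y (carrier_inv 0) by exists 0, y; split; rewrite ?add0r.
rewrite [LHS](mp_rel_uniq (xgetI 0 yr) yr).
have [C0 E0] := carrier_invP T0.
apply: (carrier_inj C0); rewrite ?E0 ?op0//; split; first exact: dom0.
by move=> z _; rewrite inner0l.
Qed.

End MoorePenrose.
End Operators.

(* Main.v *)
(** Write [T'] for the adjoint and [A^+] for the Moore-Penrose inverse.
    [N(T'T) = N(T)] because [<Tx, Tx> = <x, T'Tx>]; this makes the domain of
    [T'T] decomposable.  The domain of [T'] is decomposable because
    [N(T') = R(T)^⊥] admits an orthogonal projection.  If [y] belongs to the
    domain of [T^+ T'^+], then [y = T'z + y'] with [z] in [C(T')] and [y'] in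
    [R(T')^⊥], and [z = Tx + w] with [x] in [C(T)] and [w] in [R(T)^⊥].  Both
    [z] and [Tx] lie in [R(T)^⊥⊥], so [w = 0] and [y = T'Tx + y'], whence
    [T^+ T'^+] and [(T'T)^+] both map [y] to [x]. *)
Require Import Defs.
From mathcomp Require Import all_boot all_order all_algebra.
From mathcomp Require Import sesquilinear.
From mathcomp Require Import reals.
From mathcomp Require Import complex boolp classical_sets topology normedtype.
From mathcomp Require Import ring.

Set Implicit Arguments.
Unset Strict Implicit.
Unset Printing Implicit Defensive.

Import Order.TTheory GRing.Theory Num.Theory.
Import numFieldNormedType.Exports.

Local Open Scope classical_set_scope.
Local Open Scope ring_scope.

(** * Infima of nonnegative scalars *)

(** Norms take values in [F], whose order is only partial in the complex case; this form of the
    existence of infima covers both scalar fields. *)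
Definition nonneg_inf (F : numFieldType) := forall A : set F,
  A !=set0 -> (forall a, A a -> 0 <= a) ->
  exists2 d, lbound A d & forall e, 0 < e -> exists2 a, A a & a < d + e.

Lemma nonneg_inf_real (R : realType) : nonneg_inf R.
Proof.
move=> A A0 Age0; have lbA : has_lbound A by exists 0 => a /Age0.
exists (inf A); first exact: ge_inf.
by move=> e e0; exact: inf_adherent.
Qed.

(** Nonnegative complex numbers are real, so the infimum of the real parts serves. *)
Lemma nonneg_inf_complex (R : realType) : nonneg_inf R[i].
Proof.
move=> A [a0 Aa0] Age0.
have toR a : A a -> a = ((complex.Re a)%:C)%C.
  by move=> /Age0/ger0_Im; case: a => x y /= ->.
have [||d dA dE] := @nonneg_inf_real R [set complex.Re a | a in A].
- by exists (complex.Re a0), a0.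
- by move=> _ [a /[dup] Aa /Age0 + <-]; rewrite {1}(toR a Aa) ler0c.
exists (d%:C)%C => [a Aa|e e0].
  by rewrite (toR a Aa) lecR; apply: dA; exists a.
have eE : e = ((complex.Re e)%:C)%C.
  by move: (ltW e0) => /ger0_Im; case: (e) => x y /= ->.
move: e0; rewrite eE (ltcR 0) => /dE[_ [a Aa <-]] ae.
by exists a => //; rewrite (toR a Aa) -rmorphD/= ltcR.
Qed.

Lemma real_or_complex_nonneg_inf (R : realType) (F : numFieldType)
    (theta : involutive_rmorphism F) :
  real_or_complex R theta -> nonneg_inf F.
Proof. by case; [exact: nonneg_inf_real|exact: nonneg_inf_complex]. Qed.

(** * Orthogonal projection onto an orthogonal complement *)

Section Geometry.
Variables (F : numFieldType) (theta : involutive_rmorphism F).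
Variable H : hilbertType theta.
Implicit Types (A : set H) (x y z : H).

Lemma innerDl x y z : inner (x + y) z = inner x z + inner y z.
Proof. by rewrite -[x in LHS]scale1r inner_linearl mul1r. Qed.

Lemma innerDr x y z : inner x (y + z) = inner x y + inner x z.
Proof. by rewrite -[y in LHS]scale1r inner_linearr rmorph1 mul1r. Qed.

Lemma innerZl a x y : inner (a *: x) y = a * inner x y.
Proof. by rewrite -[a *: x]addr0 inner_linearl inner0l addr0. Qed.

Lemma parallelogram x y :
  `|x - y| ^+ 2 = 2 * `|x| ^+ 2 + 2 * `|y| ^+ 2 - `|x + y| ^+ 2.
Proof.
by rewrite !norm_innerE innerBl !innerBr innerDl !innerDr; ring.
Qed.

Lemma pythagoras x y :
  inner x y = 0 -> `|x + y| ^+ 2 = `|x| ^+ 2 + `|y| ^+ 2.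
Proof.
move=> xy; rewrite !norm_innerE innerDl !innerDr xy (inner_eq0C xy).
by rewrite addr0 add0r.
Qed.

(** For [n != 0], [t *: n] is the projection of [x] on [n], and the identity is Pythagoras. It
    yields Cauchy-Schwarz, and it makes [inner x n] small when moving [x] along [n] hardly shortens
    it. *)
Lemma inner_defect x n : exists t,
  `|inner x n| ^+ 2 = `|n| ^+ 2 * (`|x| ^+ 2 - `|x - t *: n| ^+ 2).
Proof.
have [->|n0] := eqVneq n 0.
  by exists 0; rewrite inner0r !normr0 !expr0n mul0r.
have nn0 : inner n n != 0 by rewrite -norm_innerE sqrf_eq0 normr_eq0.
pose t := inner x n / inner n n; exists t.
have xnE : inner x n = t * `|n| ^+ 2 by rewrite norm_innerE divfK.
have ort : inner (x - t *: n) (t *: n) = 0.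
  apply: inner_eq0C; rewrite innerZl innerC innerBl innerZl -norm_innerE.
  by rewrite -xnE subrr rmorph0 mulr0.
have -> : `|x| ^+ 2 = `|x - t *: n| ^+ 2 + `|t *: n| ^+ 2.
  by rewrite -(pythagoras ort) subrK.
rewrite xnE [X in _ = _ * X]addrAC subrr add0r; clearbody t.
by rewrite normrM (normrZ t n) (ger0_norm (exprn_ge0 2 (normr_ge0 n))); ring.
Qed.

Lemma inner_le_norm x y : `|inner x y| <= `|x| * `|y|.
Proof.
have [t E] := inner_defect x y.
rewrite -(@ler_pXn2r _ 2)// ?nnegrE ?mulr_ge0// E exprMn mulrC.
by rewrite ler_wpM2r ?exprn_ge0// gerBl exprn_ge0.
Qed.

Lemma orthocompl_closed_approx A y :
  (forall e, 0 < e -> exists2 m, orthocompl A m & `|y - m| < e) ->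
  orthocompl A y.
Proof.
move=> yA a Aa; apply/eqP; rewrite -normr_le0; apply/ler_addgt0Pl => e e0.
(* Adding 1 keeps the divisor positive when [a] is zero. *)
have a1 : 0 < `|a| + 1 by rewrite ltr_wpDl.
have [|m Am ym] := yA (e / (`|a| + 1)); first by rewrite divr_gt0.
have -> : inner y a = inner (y - m) a by rewrite innerBl (Am a Aa) subr0.
rewrite addr0; apply: le_trans (inner_le_norm _ _) _.
apply: (@le_trans _ _ (e / (`|a| + 1) * (`|a| + 1))); last by rewrite divfK// gt_eqF.
by apply: ler_pM => //; [exact: ltW|rewrite lerDl].
Qed.

Lemma orthocompl0 A : orthocompl A 0.
Proof. by move=> a _; rewrite inner0l. Qed.

Lemma orthocomplB A x y :
  orthocompl A x -> orthocompl A y -> orthocompl A (x - y).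
Proof.
by move=> Ax Ay; rewrite addrC -scaleN1r; exact: orthocompl_linear.
Qed.

(** Parallelogram law for [x - z] and [x - y]: their sum is twice the vector from the midpoint of
    [y] and [z] to [x], and the midpoint stays in the complement, so the squared norm of the sum is
    at least [4 * d]. *)
Lemma near_minimizers_close A x d e y z : 0 < e ->
  (forall m, orthocompl A m -> d <= `|x - m| ^+ 2) ->
  orthocompl A y -> `|x - y| ^+ 2 < d + e ^+ 2 ->
  orthocompl A z -> `|x - z| ^+ 2 < d + e ^+ 2 ->
  `|y - z| < 2 * e.
Proof.
move=> e0 dA Ay xy Az xz.
rewrite -(@ltr_pXn2r _ 2)// ?nnegrE ?mulr_ge0// ?(ltW e0)//.
have -> : y - z = (x - z) - (x - y).
  by rewrite opprB [RHS]addrC addrA subrK.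
rewrite parallelogram.
(* The trailing zero gives the midpoint the shape required by two uses of [orthocompl_linear]. *)
have mA : orthocompl A (2^-1 *: y + (2^-1 *: z + 0)).
  by do 2!apply: orthocompl_linear => //; exact: orthocompl0.
have -> : (x - z) + (x - y) = 2 *: (x - (2^-1 *: y + (2^-1 *: z + 0))).
  rewrite addr0 -scalerDr scalerBr scalerA divff ?pnatr_eq0// scale1r.
  by rewrite scaler_nat mulr2n opprD addrACA [- z - y]addrC.
rewrite normrZ exprMn ger0_norm// ltrBlDr.
apply: (@lt_le_trans _ _ (2 * (d + e ^+ 2) + 2 * (d + e ^+ 2))).
  by apply: ltrD; rewrite ltr_pM2l.
have -> : 2 * (d + e ^+ 2) + 2 * (d + e ^+ 2) = (2 * e) ^+ 2 + 2 ^+ 2 * d.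
  by ring.
by rewrite lerD2l ler_wpM2l ?exprn_ge0//; exact: dA.
Qed.

Hypothesis infF : nonneg_inf F.

(** The sets of near-minimizers of the distance to [x] generate a Cauchy filter, and its limit is
    the projection. *)
Lemma orthocompl_projection A x :
  exists2 p, orthocompl A p & orthocompl (orthocompl A) (x - p).
Proof.
have [||d dA dE] := infF (A := [set `|x - m| ^+ 2 | m in orthocompl A]).
- by exists (`|x - 0| ^+ 2), 0 => //; exact: orthocompl0.
- by move=> _ [m _ <-]; exact: exprn_ge0.
have {}dA m : orthocompl A m -> d <= `|x - m| ^+ 2.
  by move=> Am; apply: dA; exists m.
(* The slack is squared so that the diameter of [S e] is linear in [e]. *)
pose S e := [set m | orthocompl A m /\ `|x - m| ^+ 2 < d + e ^+ 2].
have S0 e : 0 < e -> S e !=set0.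
  by move=> e0; have [|_ [m Am <-] me] := dE (e ^+ 2);
    [exact: exprn_gt0|exists m].
pose G := filter_from [set e : F | 0 < e] S.
have SS e e' : 0 < e -> e <= e' -> S e `<=` S e'.
  move=> e0 ee' m [Am xm]; split=> //; apply: lt_le_trans xm _.
  by rewrite lerD2l ler_pXn2r// nnegrE ?(ltW e0)// (le_trans (ltW e0)).
have GF : ProperFilter G.
  apply: filter_from_proper => //; apply: filter_from_filter.
    by exists 1; rewrite /= ltr01.
  move=> e e' /= e0 e'0; exists (Num.min e e').
    by rewrite /= /Order.min; case: ifP.
  (* The order of [F] may be partial, but positive scalars are real and hence comparable. *)
  have := real_comparable (gtr0_real e0) (gtr0_real e'0).
  have m0 : 0 < Num.min e e' by rewrite /Order.min; case: ifP.
  by move=> c m Sm; split; apply: (SS _ _ m0 _ _ Sm);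
    rewrite comparable_ge_min// lexx ?orbT.
have Gc : cauchy G.
  apply: cauchy_exP => e e0.
  have e2 : 0 < e / 2 by rewrite divr_gt0.
  have [y [Ay xy]] := S0 _ e2; exists y; exists (e / 2) => // z [Az xz].
  rewrite -ball_normE /=.
  have := near_minimizers_close e2 dA Ay xy Az xz.
  by rewrite mulrC divfK// pnatr_eq0.
have [p /= Gp] : exists p : H, G --> p.
  by apply/cvg_ex; exact: cauchy_cvg.
have near_p e : 0 < e -> exists2 m, S e m & `|p - m| < e.
  move=> e0.
  have Se : G (S e) by exists e.
  have := Gp _ (nbhsx_ballx p e e0) => Gb.
  have [m [Sm]] := filter_ex (filterI Se Gb).
  by rewrite -ball_normE /= => pm; exists m.
exists p.
  apply: orthocompl_closed_approx => e /near_p[m [Am _] pm].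
  by exists m.
move=> n An; apply/eqP; rewrite -normr_le0; apply/ler_addgt0Pl => e e0.
have n1 : 0 < `|n| + 1 by rewrite ltr_wpDl.
(* Chosen so that each of the two terms of the splitting through [m] is at most [e / 2]. *)
pose r := e / 2 / (`|n| + 1).
have r0 : 0 < r by rewrite !divr_gt0.
have rn : r * `|n| <= e / 2.
  by rewrite -mulrA ler_piMr ?divr_ge0 ?(ltW e0)// mulrC ler_pdivrMr// mul1r lerDl.
have [m [Am xm] pm] := near_p _ r0.
clearbody r; have -> : inner (x - p) n = inner (x - m) n - inner (p - m) n.
  by rewrite -innerBl opprB addrA subrK.
rewrite addr0 (splitr e); apply: le_trans (ler_normB _ _) _; apply: lerD.
  apply: le_trans rn; rewrite -(@ler_pXn2r _ 2)// ?nnegrE ?mulr_ge0 ?(ltW r0)//.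
  (* Since [t *: n + m] stays in the complement, its squared distance to [x] is at least [d], while
     that of [m] is below [d + r ^+ 2]; the defect is thus at most [r ^+ 2]. *)
  have [t ->] := inner_defect (x - m) n.
  rewrite exprMn mulrC ler_wpM2r ?exprn_ge0// lerBlDr.
  apply: (le_trans (ltW xm)); rewrite addrC lerD2l.
  have -> : x - m - t *: n = x - (t *: n + m) by rewrite opprD addrA addrAC.
  by apply: dA; exact: orthocompl_linear.
apply: le_trans rn; apply: le_trans (inner_le_norm _ _) _.
by rewrite ler_wpM2r// ltW.
Qed.

End Geometry.

(** * Null spaces and decomposable domains of [T'] and [T'T] *)

Section Operators.
Variables (F : numFieldType) (theta : involutive_rmorphism F).

Lemma subset_orthocompl (H : hilbertType theta) (A B : set H) :
  A `<=` B -> orthocompl B `<=` orthocompl A.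
Proof. by move=> AB x Bx a /AB/Bx. Qed.

Lemma orthosum_carrier_dom (H K : hilbertType theta) (T : operator H K) :
  orthosum (null T) (carrier T) `<=` dom T.
Proof.
by move=> _ [n [Tn _] [c [Tc _] <-]]; rewrite -[n]scale1r; exact: dom_linear.
Qed.

Variables (H K : hilbertType theta) (T : operator H K) (dT : densely_defined T).

Lemma null_adjoint : null (adjoint dT) = orthocompl (ran T).
Proof.
apply/seteqP; split => [y [Ty y0] _ [x Tx <-]|y Ty].
  by apply: inner_eq0C; rewrite (adjointP Tx Ty) y0 inner0r.
(* Zero is an admissible adjoint value at [y]; density of the domain makes it the only one. *)
have y0 : adj_rel T y 0.
  by move=> x Tx; rewrite inner0r; apply: inner_eq0C; apply: Ty; exists x.
have yD : dom (adjoint dT) y by exists 0.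
by split=> //; exact: (adj_rel_uniq dT (adj_relP yD) y0).
Qed.

Lemma decomposable_adjoint :
  nonneg_inf F -> decomposable_domain (adjoint dT).
Proof.
move=> infF; apply/seteqP; split; last exact: orthosum_carrier_dom.
move=> y Ty; have [p pT py] := orthocompl_projection infF (ran T) y.
rewrite /orthosum /carrier null_adjoint; exists p => //.
exists (y - p); last by rewrite addrC subrK.
(* The projection [p] lies in the null space of the adjoint, so [y - p] remains in its domain. *)
by split=> //; apply: domB => //; move: pT; rewrite -null_adjoint => -[].
Qed.

Lemma null_adjoint_comp : null (op_comp (adjoint dT) T) = null T.
Proof.
apply/seteqP; split => x /=; last first.
  move=> [Tx x0]; rewrite /null /= /comp_dom /= x0.
  by split; [split=> //; exact: adj_dom0|exact: (op0 (adjoint dT))].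
move=> [[Tx Tax] x0]; split=> //; apply: inner_self_eq0.
by rewrite (adjointP Tx Tax); move: x0 => /= ->; exact: inner0r.
Qed.

Lemma decomposable_adjoint_comp : decomposable_domain T ->
  decomposable_domain (op_comp (adjoint dT) T).
Proof.
move=> hT; apply/seteqP; split; last exact: orthosum_carrier_dom.
move=> x /[dup] Dx [Tx _]; rewrite /orthosum /carrier null_adjoint_comp.
move: (Tx); rewrite {1}hT => -[n Nn [c [Tc cN] ncx]].
have [Dn _] : null (op_comp (adjoint dT) T) n by rewrite null_adjoint_comp.
exists n => //; exists c => //; split=> //.
(* Here [c = x - n], and both terms lie in the domain of [T'T]. *)
by rewrite -(addKr n c) ncx addrC; exact: domB.
Qed.

End Operators.

(** * Moore-Penrose inverses through carrier vectors, and the inclusion *)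

(** Injectivity of [T] on its carrier forces [carrier_inv] to return [x] at [T x]. *)
Lemma mp_inverse_eq (F : numFieldType) (theta : involutive_rmorphism F)
    (H K : hilbertType theta) (T : operator H K) (hT : decomposable_domain T)
    x y : carrier T x -> orthocompl (ran T) y ->
  dom (mp_inverse hT) (T x + y) /\ mp_inverse hT (T x + y) = x.
Proof.
move=> Cx Ty; have Rx : ran T (T x) by exists x => //; exact: Cx.1.
have D : mp_dom T (T x + y) by exists (T x) => //; exists y.
split=> //; apply: (mp_rel_uniq (mp_relP D)).
exists (T x), y; split=> //.
by have [Ci Ei] := carrier_invP hT Rx; exact/esym/(carrier_inj Ci).
Qed.

Lemma mp_domP (F : numFieldType) (theta : involutive_rmorphism F)
    (H K : hilbertType theta) (T : operator H K) (hT : decomposable_domain T)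
    z : dom (mp_inverse hT) z ->
  exists x y, [/\ carrier T x, orthocompl (ran T) y & z = T x + y].
Proof.
move=> [_ /(ran_carrier hT)[x Cx <-] [y Ty <-]].
by exists x, y.
Qed.

Theorem theorem2p6 (R : realType) (F : numFieldType)
    (theta : involutive_rmorphism F) (hF : real_or_complex R theta)
    (H K : hilbertType theta) (T : operator H K)
    (dT : densely_defined T) (cT : closable T)
    (hT : decomposable_domain T) :
  exists (hTa : decomposable_domain (adjoint dT))
         (hTaT : decomposable_domain (op_comp (adjoint dT) T)),
    extends (mp_inverse hTaT) (op_comp (mp_inverse hT) (mp_inverse hTa)).
Proof.
have hTa := decomposable_adjoint dT (real_or_complex_nonneg_inf hF).
have hTaT := decomposable_adjoint_comp dT hT.
exists hTa, hTaT.
suff E y : dom (mp_inverse hTa) y -> dom (mp_inverse hT) (mp_inverse hTa y) ->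
    dom (mp_inverse hTaT) y /\
    mp_inverse hTaT y = mp_inverse hT (mp_inverse hTa y).
  by split=> y [Dy Dy']; have [] := E y Dy Dy'.
move=> /mp_domP[z [y' [Cz y'T ->]]].
have [_ ->] := mp_inverse_eq hTa Cz y'T.
move=> /mp_domP[x [w [Cx wT zxw]]].
(* With [w = z - T x], both [z] and [T x] are orthogonal to [w]: the former because [w] lies in the
   null space of the adjoint. *)
have w0 : w = 0.
  apply: inner_self_eq0; have [_ zN] := Cz.
  rewrite -{1}(addKr (T x) w) -zxw addrC innerBl zN ?null_adjoint// sub0r.
  by rewrite (inner_eq0C (wT (T x) _)) ?oppr0//; exists x => //; exact: Cx.1.
have [_] := mp_inverse_eq hT Cx wT; rewrite -zxw => ->.
move: Cz; rewrite zxw w0 addr0 => Cz.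
apply: (@mp_inverse_eq _ _ _ _ (op_comp (adjoint dT) T)).
  split; first by split; [exact: Cx.1|exact: Cz.1].
  by rewrite null_adjoint_comp; exact: Cx.2.
(* The range of [T'T] lies in that of [T'], so the complements are included in reverse. *)
by apply: subset_orthocompl y'T => _ [u [_ Du] <-]; exists (T u).
Qed.
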